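(* There exists an infinite family $\{X_n\}_{n\in\mathbb{N}}$ of finite $2$-dimensional simplicial complexes such that (1) each $X_n$ is collapsible to a point, and (2) the $1$-skeleta $\{X_n^{\le 1}\}_{n}$ form a bounded-degree expander family.
   Context: Collapsible: reducible to a point by a finite sequence of elementary collapses (removing a PL disk $D^n$ meeting the remainder in a face $D^{n-1}$ of it). A family of finite graphs $\{G_n\}$ is a bounded-degree expander family if the vertex degrees are uniformly bounded and there is $\alpha>0$ such that for all $n$ and $A\subseteq V(G_n)$ with $|A|\le\frac12|V(G_n)|$, the number of edges between $A$ and $V(G_n)\setminus A$ is at least $\alpha|A|$. *)

(* Defs.v *)
From HB Require Import structures.
From mathcomp Require Import all_boot all_order all_algebra.
From mathcomp Require Import boolp classical_sets functions reals.

Set Implicit Arguments.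
Unset Strict Implicit.
Unset Printing Implicit Defensive.

Import Order.TTheory GRing.Theory Num.Theory.

Local Open Scope ring_scope.
Local Open Scope classical_set_scope.

Record graph := Graph {
  gvertex :> finType;
  adj : rel gvertex;
  adj_sym : symmetric adj;
  adj_irr : irreflexive adj }.

Definition degree (G : graph) (x : G) : nat := #|[set y | adj x y]%SET|.

(* Each edge between A and its complement is counted once, oriented from its
   endpoint in A to its endpoint outside A. *)
Definition edge_boundary (G : graph) (A : {set G}) : {set G * G} :=
  [set p | [&& p.1 \in A, p.2 \notin A & adj p.1 p.2]]%SET.

Definition bounded_degree_expander_family (R : realType) (G : nat -> graph) :=
  (exists d : nat, forall n (x : G n), (degree x <= d)%N) /\
  (exists2 alpha : R, 0 < alpha &
    forall n (A : {set G n}), (2 * #|A| <= #|G n|)%N ->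
      alpha * #|A|%:R <= #|edge_boundary A|%:R).

Record simplicial_complex := SimplicialComplex {
  svertex :> finType;
  faces : {set {set svertex}};
  face_neq0 : finset.set0 \notin faces;
  face_vertex : forall v, [set v]%SET \in faces;
  face_sub : forall s t : {set svertex},
    s \in faces -> t \subset s -> t != finset.set0 -> t \in faces }.

Definition dimension (X : simplicial_complex) : nat :=
  (\max_(s in faces X) #|s|.-1)%N.

Definition skel_adj (X : simplicial_complex) : rel X :=
  fun x y => (x != y) && ([set x; y]%SET \in faces X).

Lemma skel_adj_sym (X : simplicial_complex) : symmetric (@skel_adj X).
Proof. by move=> x y; rewrite /skel_adj eq_sym finset.setUC. Qed.

Lemma skel_adj_irr (X : simplicial_complex) : irreflexive (@skel_adj X).
Proof. by move=> x; rewrite /skel_adj eqxx. Qed.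

Definition one_skeleton (X : simplicial_complex) : graph :=
  Graph (@skel_adj_sym X) (@skel_adj_irr X).

Section PiecewiseLinear.
Variable R : realType.

Definition convex_weights (k : nat) (t : 'I_k -> R) : Prop :=
  (forall i, 0 <= t i) /\ \sum_i t i = 1.

Definition hull (N : nat) (s : seq 'rV[R]_N) : set 'rV[R]_N :=
  [set x | exists2 t : 'I_(size s) -> R,
    convex_weights t & x = \sum_i t i *: s`_i].

(* Compact polyhedra: finite unions of polytopes. *)
Definition polyhedron (N : nat) (P : set 'rV[R]_N) : Prop :=
  exists cells : seq (seq 'rV[R]_N), P = \bigcup_(s in [set` cells]) hull s.

(* f is affine on each polytope of some finite cover of P by polytopes;
   continuity on P is then automatic, since the cells are closed. *)
Definition PL_map (M N : nat) (P : set 'rV[R]_M) (f : 'rV[R]_M -> 'rV[R]_N) :=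
  exists2 cells : seq (seq 'rV[R]_M), P = \bigcup_(s in [set` cells]) hull s &
    forall s, s \in cells -> forall t : 'I_(size s) -> R, convex_weights t ->
      f (\sum_i t i *: s`_i) = \sum_i t i *: f s`_i.

(* The inverse of a PL bijection between compact polyhedra is again PL. *)
Definition PL_homeo (M N : nat) (P : set 'rV[R]_M) (Q : set 'rV[R]_N)
    (f : 'rV[R]_M -> 'rV[R]_N) : Prop :=
  PL_map P f /\ set_bij P Q f.

Definition std_simplex (n : nat) : set 'rV[R]_n.+1 :=
  [set x | (forall i, 0 <= x 0 i) /\ \sum_i x 0 i = 1].

Definition std_simplex_boundary (n : nat) : set 'rV[R]_n.+1 :=
  [set x | std_simplex x /\ exists i, x 0 i = 0].

Definition PL_disk (N n : nat) (D : set 'rV[R]_N) : Prop :=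
  exists f, PL_homeo (@std_simplex n) D f.

(* A face of the PL (n+1)-disk D is a PL n-disk in the boundary of D. *)
Definition disk_face (N n : nat) (D F : set 'rV[R]_N) : Prop :=
  PL_disk n F /\
  exists2 f, PL_homeo (@std_simplex n.+1) D f &
    F `<=` f @` @std_simplex_boundary n.+1.

Definition elementary_collapse (N : nat) (P Q : set 'rV[R]_N) : Prop :=
  polyhedron Q /\
  exists (n : nat) (D : set 'rV[R]_N),
    [/\ PL_disk n.+1 D, P = Q `|` D & disk_face n D (Q `&` D)].

Inductive collapses (N : nat) (P : set 'rV[R]_N) : set 'rV[R]_N -> Prop :=
| collapses_refl : collapses P P
| collapses_step Q S :
    collapses P Q -> elementary_collapse Q S -> collapses P S.

Definition collapsible (N : nat) (P : set 'rV[R]_N) : Prop :=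
  exists x, collapses P [set x].

(* Geometric realization in R^V: the vertex v is the basis vector e_v. *)
Definition realization (X : simplicial_complex) : set 'rV[R]_#|X| :=
  \bigcup_(s in [set` faces X])
    hull [seq delta_mx 0 (enum_rank v) | v <- enum s].

End PiecewiseLinear.

(* Main.v *)
Require Import Defs.
From HB Require Import structures.
From mathcomp Require Import all_boot all_order all_algebra.
From mathcomp Require Import boolp classical_sets functions reals.
From mathcomp Require Import zify ring lra.

(* The vertices of X_n form a tower of groups (F_2[t]/t^k)^2, k <= n+1, each
   element being joined to its reduction modulo t^(k-1).  On every level two
   vertices are adjacent when they differ by one of six affine maps: the
   elementary matrices with off-diagonal entry 1 or t, and two translations.
   These maps commute with reduction, so every horizontal edge spans a square
   with the edge of the parents; two triangles fill it, and the last level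
   collapses onto the previous one through the horizontal edges, then the
   diagonals, then the vertices.

   Expansion follows from a Poincare inequality on the last level, since the
   other levels are carried along by the 4-to-1 tree.  Characters of
   (F_2[t]/t^k)^2 take the values 1 and -1.  If f has small energy, the two
   translations force the mass of its Walsh transform onto pairs (z1, z2) with
   |z1|, |z2| small enough for the dual matrices to act without wraparound.
   The matrices with entry t map {|z1| >= |z2|} into {|z1| < |z2|} and
   symmetrically, those with entry 1 map {|z1| <> |z2|} into {|z1| = |z2|};
   almost invariance of the mass leaves only z = 0, where the transform of a
   function of mean zero vanishes. *)

Set Implicit Arguments.
Unset Strict Implicit.
Unset Printing Implicit Defensive.

Import Order.TTheory GRing.Theory Num.Theory.

(** * A Poincare inequality on words *)

Definition letter : Type := bool * bool.
HB.instance Definition _ := Finite.on letter.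

Definition zero_letter : letter := (false, false).

Definition add_letter (c d : letter) : letter := (c.1 (+) d.1, c.2 (+) d.2).

Definition coord (i : bool) (c : letter) : bool := if i then c.2 else c.1.

Definition unit_letter (i b : bool) : letter := if i then (false, b) else (b, false).

(* The word c_(k-1) ... c_0 stands for the element of (F_2[t]/t^k)^2 whose
   coefficient of t^j is c_j; deleting the first letter is reduction modulo
   t^(k-1).  For Some false and Some true, move_incr describes the elementary
   matrices with off-diagonal entry 1 and t; for None, the translation by a
   basis vector. *)
Definition move_index : Type := bool * option bool.
HB.instance Definition _ := Finite.on move_index.

Definition move_incr (g : move_index) (c : letter) (s : seq letter) : letter :=
  unit_letter g.1
    match g.2 with
    | None => nilp s
    | Some false => coord (~~ g.1) c
    | Some true => coord (~~ g.1) (head zero_letter s)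
    end.

Fixpoint move (g : move_index) (s : seq letter) : seq letter :=
  if s is c :: s' then add_letter c (move_incr g c s') :: move g s' else [::].

Lemma size_move g s : size (move g s) = size s.
Proof. by elim: s => //= c s ->. Qed.

Lemma behead_move g s : behead (move g s) = move g (behead s).
Proof. by case: s. Qed.

Lemma moveK g : involutive (move g).
Proof.
elim=> //= c s ->; congr (_ :: _).
case: g => [] [] [[]|] /=; case: c => [] [] [] //=; case: s => [|[[] []] s] //=.
Qed.

(** * The transposed action of the matrices on characters *)

Definition dual_shear (i : bool) (c : letter) : letter :=
  add_letter c (unit_letter (~~ i) (coord i c)).

(** Transpose of the matrix with entry t. Read the letters of a character as its coefficients at
    t^-k, ..., t^-1: multiplication by t moves each one place to the right, [a] being the letter
    that enters on the left, and what leaves on the right is lost. *)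
Fixpoint dual_shift (i : bool) (a : letter) (s : seq letter) : seq letter :=
  if s is c :: s' then
    add_letter c (unit_letter (~~ i) (coord i a)) :: dual_shift i c s'
  else [::].

Lemma dual_shearK i : involutive (dual_shear i).
Proof. by case: i => [] [[] []]. Qed.

Lemma size_dual_shift i a s : size (dual_shift i a s) = size s.
Proof. by elim: s a => //= c s IH a; rewrite IH. Qed.

Lemma dual_shift_inj i a : injective (dual_shift i a).
Proof.
move=> s; elim: s a => [|c s IH] a [|d t] //= [].
case: i IH => IH; case: c d a => [c1 c2] [d1 d2] [a1 a2] /=;
  rewrite ?addbF => h1 h2.
- by move: h1 h2 => /addIb -> -> /IH ->.
- by move: h1 h2 => -> /addIb -> /IH ->.
Qed.

Lemma dual_shift_rcons i a s c :
  dual_shift i a (rcons s c) =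
  rcons (dual_shift i a s)
    (add_letter c (unit_letter (~~ i) (coord i (last a s)))).
Proof. by elim: s a => //= d s IH a; rewrite IH. Qed.

(* The last nonzero letter of a character tells which of its two components
   has the larger absolute value in F_2((1/t)). *)
Definition last_nonzero (s : seq letter) : letter :=
  foldl (fun a c => if c == zero_letter then a else c) zero_letter s.

Lemma last_nonzero_rcons s c :
  last_nonzero (rcons s c) = if c == zero_letter then last_nonzero s else c.
Proof. by rewrite /last_nonzero foldl_rcons. Qed.

Lemma last_nonzero_eq0 s :
  last_nonzero s = zero_letter -> s = nseq (size s) zero_letter.
Proof.
elim/last_ind: s => // s c IH; rewrite last_nonzero_rcons size_rcons.
case: eqVneq => [-> /IH {1}->|/negP c0 /eqP //].
by rewrite -cats1 cat_nseq /ncons -iterSr.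
Qed.

Lemma last_nonzero_shear i s :
  last_nonzero (map (dual_shear i) s) = dual_shear i (last_nonzero s).
Proof.
elim/last_ind: s => [|s c IH]; first by case: i.
rewrite map_rcons !last_nonzero_rcons IH.
by case: i {IH}; case: c => [] [] [].
Qed.

(** Component [i] has maximal absolute value, so |t z_i| exceeds both |z_1| and |z_2|; once t z_i is
    added, the other component strictly dominates. The zero last letter guarantees that the product
    by t loses nothing. *)
Lemma last_nonzero_shift i s :
  coord i (last_nonzero s) -> last zero_letter s = zero_letter ->
  last_nonzero (dual_shift i zero_letter s) = unit_letter (~~ i) true.
Proof.
elim/last_ind: s => [|s c IH]; first by case: i.
rewrite last_nonzero_rcons last_rcons => + c0; rewrite {}c0 eqxx => hc.
rewrite dual_shift_rcons last_nonzero_rcons.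
have [s0|s0] := eqVneq (last zero_letter s) zero_letter.
  by rewrite s0 IH //; case: i {hc IH}.
have {}hc : coord i (last zero_letter s).
  case/lastP: s hc s0 {IH} => [|s d]; first by case: i.
  by rewrite last_nonzero_rcons last_rcons => + /negbTE d0; rewrite d0.
by rewrite hc; case: i {hc IH}.
Qed.

Fixpoint pairing (x z : seq letter) : bool :=
  match x, z with
  | c :: s, d :: t => (c.1 && d.1) (+) (c.2 && d.2) (+) pairing s t
  | _, _ => false
  end.

Lemma pairing0 n x : pairing x (nseq n zero_letter) = false.
Proof. by elim: n x => [|n IH] [|c s] //=; rewrite IH !andbF. Qed.

Lemma pairing_shear i x z :
  pairing (move (i, Some false) x) z = pairing x (map (dual_shear i) z).
Proof.
elim: x z => [|c s IH] [|d t] //=; rewrite IH; congr (_ (+) _).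
by case: i {IH}; case: c d => [] [] [] [[] []].
Qed.

(** The arbitrary incoming letter [a] makes the induction go through; it is seen only by the head of
    [x]. *)
Lemma pairing_shift_acc i x z a : size x = size z ->
  pairing x (dual_shift i a z) =
  pairing (move (i, Some true) x) z
    (+) (coord (~~ i) (head zero_letter x) && coord i a).
Proof.
elim: x z a => [|c s IH] [|d t] a //=; first by case: i.
move=> [/IH ->].
rewrite /move_incr /= {IH}; move: (pairing _ _) (head _ _) => p h.

by case: i; case: c d a h p => [] [] [] [[] []] [[] []] [[] []] [].
Qed.

Lemma pairing_shift i x z : size x = size z ->
  pairing (move (i, Some true) x) z = pairing x (dual_shift i zero_letter z).
Proof. by move=> h; rewrite pairing_shift_acc //; case: i; rewrite andbF addbF. Qed.

(** The translation changes only the constant coefficient, which is the last letter. *)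
Lemma pairing_translation i x z : size x = size z ->
  pairing (move (i, None) x) z = pairing x z (+) coord i (last zero_letter z).
Proof.
elim: x z => [|c s IH] [|d t] //=; first by case: i.
case=> h; rewrite IH // addbA.
have -> : coord i (last zero_letter t) = ~~ nilp s && coord i (last zero_letter t).
  by move: h; clear; case: s t => [|? ?] [|? ?]; case: i.
have -> : coord i (last d t) =
  if nilp s then coord i d else coord i (last zero_letter t).
  by move: h; clear; case: s t => [|? ?] [|? ?].
rewrite /move_incr /=; move: (pairing _ _) (coord i (last _ _)) => p q.
by clear; case: (nilp s); case: i; case: c d q p => [] [] [] [[] []] [] [].
Qed.

(** * Walsh transform and transport of spectral mass *)

Section Walsh.
Local Open Scope ring_scope.
Variable R : realFieldType.
Implicit Types F f : seq letter -> R.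

Lemma sum_tupleS k F :
  \sum_(x : k.+1.-tuple letter) F x =
  \sum_(c : letter) \sum_(s : k.-tuple letter) F (c :: s).
Proof.
rewrite pair_big /=.
rewrite (reindex (fun p : letter * k.-tuple letter => [tuple of p.1 :: p.2])) //=.
exists (fun x : k.+1.-tuple letter => (thead x, [tuple of behead x])).
  by move=> [c s] _; congr (_, _); apply/val_inj.
by move=> x _; rewrite [in RHS](tuple_eta x).
Qed.

Lemma sum_tuple0 F : \sum_(x : 0.-tuple letter) F x = F [::].
Proof.
by rewrite (big_pred1 [tuple]) => [//|x]; symmetry; apply/eqP/tuple0.
Qed.

Lemma sum_letter (G : letter -> R) :
  \sum_c G c = G (false, false) + G (false, true) + G (true, false) + G (true, true).
Proof.
transitivity (\sum_a \sum_b G (a, b)); last first.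
  by rewrite !big_bool /=; ring.
by rewrite pair_bigA; apply: eq_bigr => -[].
Qed.

Lemma reindex_size_inj k (g : seq letter -> seq letter) F :
  (forall s, size (g s) = size s) -> injective g ->
  \sum_(x : k.-tuple letter) F x = \sum_(x : k.-tuple letter) F (g x).
Proof.
move=> gs gi.
have gt (x : k.-tuple letter) : size (g x) == k by rewrite gs size_tuple.
pose h x := Tuple (gt x).
have hi : injective h by move=> x y /(congr1 val)/gi/val_inj.
by rewrite (reindex h) //=; apply: onW_bij; apply: injF_bij.
Qed.

Definition character (x z : seq letter) : R := (-1) ^+ pairing x z.

Lemma character_orthogonal k x y : size x = k -> size y = k ->
  \sum_(z : k.-tuple letter) character x z * character y z =
  (4 ^ k)%:R * (x == y)%:R.
Proof.
elim: k x y => [|k IH] [|c s] [|d t] //=.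
  by rewrite (sum_tuple0 (fun z => character [::] z * character [::] z))
    /character /= !mul1r.
move=> [sk] [tk].
rewrite (sum_tupleS _ (fun z => character (c :: s) z * character (d :: t) z)).
pose sgn (u v : letter) : R := (-1) ^+ ((u.1 && v.1) (+) (u.2 && v.2)).
have -> : \sum_e \sum_(z : k.-tuple letter)
    character (c :: s) (e :: z) * character (d :: t) (e :: z) =
  \sum_e (sgn c e * sgn d e) * \sum_(z : k.-tuple letter) character s z * character t z.
  apply: eq_bigr => e _; rewrite mulr_sumr; apply: eq_bigr => z _.
  by rewrite /character /sgn /= !signr_addb; ring.
rewrite -mulr_suml IH // eqseq_cons expnS natrM -mulnb natrM.
have -> : \sum_e sgn c e * sgn d e = 4%:R * (c == d)%:R.
  rewrite sum_letter /sgn.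
  by case: c d => [] [] [] [[] []]; rewrite /= ?expr0 ?expr1 ?mulr0 ?mulr1; lra.
by ring.
Qed.

(** Left unnormalised, whence the factor [4 ^ k] in front of every sum of squares and every energy
    below. *)
Definition walsh k f z : R := \sum_(x : k.-tuple letter) f x * character x z.

Lemma walsh_plancherel k f :
  \sum_(z : k.-tuple letter) walsh k f z ^+ 2 =
  (4 ^ k)%:R * \sum_(x : k.-tuple letter) f x ^+ 2.
Proof.
transitivity (\sum_(x : k.-tuple letter) \sum_(y : k.-tuple letter)
   f x * f y * \sum_(z : k.-tuple letter) character x z * character y z).
  under eq_bigr => z _.
    rewrite expr2 /walsh mulr_suml; under eq_bigr => x _ do rewrite mulr_sumr.
    over.
  rewrite exchange_big /=; apply: eq_bigr => x _.
  rewrite exchange_big /=; apply: eq_bigr => y _.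
  by rewrite mulr_sumr; apply: eq_bigr => z _; ring.
rewrite mulr_sumr; apply: eq_bigr => x _.
rewrite (bigD1 x) //= [X in _ + X = _]big1 => [|y yx].
  by rewrite character_orthogonal ?size_tuple // eqxx mulr1; ring.
rewrite character_orthogonal ?size_tuple //.
by rewrite (_ : (_ == _) = false) ?mulr0 //; apply/eqP => /val_inj h; rewrite h eqxx in yx.
Qed.

Lemma walsh_comp k f g (h : seq letter -> seq letter) (z : k.-tuple letter) :
  (forall x : k.-tuple letter, pairing (move g x) z = pairing x (h z)) ->
  walsh k (fun x => f (move g x)) z = walsh k f (h z).
Proof.
move=> hh; rewrite /walsh (@reindex_size_inj _ _ (fun x => f (move g x) * character x z)
  (size_move g) (can_inj (moveK g))).
by apply: eq_bigr => x _; rewrite moveK /character hh.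
Qed.

Definition energy k f g : R :=
  \sum_(x : k.-tuple letter) (f (move g x) - f x) ^+ 2.

Lemma walsh_sub k f1 f2 z :
  walsh k (fun x => f1 x - f2 x) z = walsh k f1 z - walsh k f2 z.
Proof. by rewrite /walsh -sumrB; apply: eq_bigr => x _; rewrite mulrBl. Qed.

Lemma energy_walsh k f g (h : seq letter -> seq letter) :
  (forall (x z : k.-tuple letter), pairing (move g x) z = pairing x (h z)) ->
  (4 ^ k)%:R * energy k f g =
  \sum_(z : k.-tuple letter) (walsh k f (h z) - walsh k f z) ^+ 2.
Proof.
move=> hh; rewrite -(walsh_plancherel k (fun x => f (move g x) - f x)).
apply: eq_bigr => z _.
by rewrite walsh_sub (walsh_comp _ (h := h)).
Qed.

(** Translating [f] multiplies its coefficient at [z] by a sign, which is -1 on the selected [z];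
    the difference is then twice the coefficient in absolute value. *)
Lemma energy_translation k f i :
  \sum_(z : k.-tuple letter | coord i (last zero_letter z)) walsh k f z ^+ 2 <=
  (4 ^ k)%:R * energy k f (i, None).
Proof.
rewrite -(walsh_plancherel k (fun x => f (move (i, None) x) - f x)) big_mkcond /=.
apply: ler_sum => z _.
case: ifP => [hz|_]; last exact: sqr_ge0.
rewrite walsh_sub.
have -> : walsh k (fun x => f (move (i, None) x)) z = - walsh k f z.
  rewrite /walsh (@reindex_size_inj _ _ (fun x => f (move (i, None) x) * character x z)
    (size_move (i, None)) (can_inj (moveK (i, None)))).
  rewrite -sumrN; apply: eq_bigr => x _.
  rewrite moveK /character pairing_translation ?size_tuple // hz.
  by rewrite signr_addb expr1 mulrN1 mulrN.
by have := sqr_ge0 (walsh k f z); nra.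
Qed.

Definition mass k f (P : pred (seq letter)) : R :=
  \sum_(z : k.-tuple letter | P z) walsh k f z ^+ 2.

(** Termwise, 3/2 b^2 + 3 (b - a)^2 - a^2 = (3 b - 2 a)^2 / 2. The factor r = 3/2 is chosen with r
    (r - 1) < 1, which lets the inequalities of [poincare] be absorbed. *)
Lemma mass_transport k f g (h : seq letter -> seq letter) (P Q : pred (seq letter)) :
  (forall s, size (h s) = size s) -> injective h ->
  (forall (x z : k.-tuple letter), pairing (move g x) z = pairing x (h z)) ->
  (forall z, P z -> Q (h z)) ->
  mass k f P <= 3 / 2 * mass k f Q + 3 * ((4 ^ k)%:R * energy k f g).
Proof.
move=> hs hi hh hPQ; rewrite (energy_walsh _ hh) /mass big_mkcond [X in _ * X + _]big_mkcond /=.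
rewrite (@reindex_size_inj _ _ (fun z => if Q z then walsh k f z ^+ 2 else 0) hs hi).
rewrite !mulr_sumr -big_split /=.
apply: ler_sum => z _; move: (hPQ z).
case: (P z) => [/(_ isT) ->|_].
  set a := walsh _ _ _; set b := walsh _ _ _.
  by have := sqr_ge0 (3 * b - 2 * a); nra.
have [h1 h2] : 0 <= 3 / 2 :> R /\ 0 <= 3 :> R by split; lra.
by apply: addr_ge0; apply: mulr_ge0; rewrite ?sqr_ge0 //; case: ifP; rewrite ?sqr_ge0.
Qed.

Lemma mass_le k f (P Q1 Q2 : pred (seq letter)) :
  (forall z, P z -> Q1 z || Q2 z) ->
  mass k f P <= mass k f Q1 + mass k f Q2.
Proof.
move=> PQ; rewrite /mass [X in X <= _]big_mkcond [X in _ <= X + _]big_mkcond.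
rewrite [X in _ <= _ + X]big_mkcond -big_split /=; apply: ler_sum => z _.
have := PQ z; have := sqr_ge0 (walsh k f z).
move: (walsh _ _ _ ^+ 2) => w w0.
by case: (P z) (Q1 z) (Q2 z) => [] [] [] //=; try (by move/(_ isT)); move=> _; lra.
Qed.

Lemma mass_disjoint k f (P Q1 Q2 : pred (seq letter)) :
  (forall z, P z = Q1 z || Q2 z) -> (forall z, ~~ (Q1 z && Q2 z)) ->
  mass k f P = mass k f Q1 + mass k f Q2.
Proof.
move=> PQ PQ'; rewrite /mass [LHS]big_mkcond [X in _ = X + _]big_mkcond.
rewrite [X in _ = _ + X]big_mkcond -big_split /=; apply: eq_bigr => z _.
have := PQ z; have := PQ' z.
by case: (P z); case: (Q1 z); case: (Q2 z) => //= _; rewrite ?addr0 ?add0r.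
Qed.

Lemma poincare k f : \sum_(x : k.-tuple letter) f x = 0 ->
  \sum_(x : k.-tuple letter) f x ^+ 2 <= 40 * \sum_g energy k f g.
Proof.
move=> f0.
have k0 : 0 < (4 ^ k)%:R :> R by rewrite ltr0n expn_gt0.
rewrite -(ler_pM2l k0) -walsh_plancherel.
have -> : (4 ^ k)%:R * (40 * \sum_g energy k f g) =
          40 * \sum_g (4 ^ k)%:R * energy k f g by rewrite -mulr_sumr; ring.
(* [box] consists of the characters that can be multiplied by t without overflow; [cls] splits it
   according to the dominant component, and [W] is the mass outside it. *)
pose box z := last zero_letter z == zero_letter.
pose cls c z := box z && (last_nonzero z == c).
pose m c := mass k f (cls c).
pose W := mass k f (predC box).
pose D g : R := (4 ^ k)%:R * energy k f g.
have D0 g : 0 <= D g.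
  by apply: mulr_ge0; [exact: ltW | apply: sumr_ge0 => x _; exact: sqr_ge0].
have WD : W <= D (false, None) + D (true, None).
  have WM : W <= mass k f (fun z => coord false (last zero_letter z)) +
                 mass k f (fun z => coord true (last zero_letter z)).
    by apply: mass_le => z; rewrite /= /box; case: (last _ _) => [] [] [].
  by apply: (le_trans WM); apply: lerD; exact: energy_translation.
have lnW c : mass k f (fun z => last_nonzero z == c) <= m c + W.
  by apply: mass_le => z hz; rewrite /cls hz andbT /= orbN.
(* Multiplication by t sends the two classes where component [i] is maximal into the one where the
   other component dominates. The image may leave [box], which costs [W]. *)
have shift i : m (unit_letter i true) + m (true, true) <=
    3 / 2 * (m (unit_letter (~~ i) true) + W) + 3 * D (i, Some true).
  rewrite /m -(@mass_disjoint _ _ (fun z => box z && coord i (last_nonzero z))).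
  - apply: le_trans (mass_transport f (g := (i, Some true))
      (h := dual_shift i zero_letter)
      (Q := fun z => last_nonzero z == unit_letter (~~ i) true) _ _ _ _) _.
    + exact: size_dual_shift.
    + exact: dual_shift_inj.
    + by move=> x z; apply: pairing_shift; rewrite !size_tuple.
    + by move=> z /andP[/eqP bz cz]; apply/eqP; exact: last_nonzero_shift.
    by rewrite lerD2r; apply: ler_wpM2l; [lra|exact: lnW].
  - by move=> z; rewrite /cls -andb_orr; case: i; case: last_nonzero => [] [] [].
  - by move=> z; rewrite /cls; case: (box z); case: i; case: last_nonzero => [] [] [].
(* Adding the strictly dominant component to the other one makes them equal in size. *)
have shear i : m (unit_letter i true) <=
    3 / 2 * (m (true, true) + W) + 3 * D (i, Some false).
  apply: le_trans (mass_transport f (g := (i, Some false))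
    (h := map (dual_shear i)) (Q := fun z => last_nonzero z == (true, true)) _ _ _ _) _.
  - by move=> s; rewrite size_map.
  - exact/inj_map/inv_inj/dual_shearK.
  - by move=> x z; exact: pairing_shear.
  - by move=> z /andP[_ /eqP hz]; rewrite last_nonzero_shear hz; case: (i).
  by rewrite lerD2r; apply: ler_wpM2l; [lra|exact: lnW].
(* This class contains only the trivial character, where the transform is the sum of [f]. *)
have m0 : m zero_letter = 0.
  rewrite /m /mass big1 // => z /andP[_ /eqP /last_nonzero_eq0 ->].
  rewrite (_ : walsh k f _ = 0) ?expr0n // -[RHS]f0.
  by apply: eq_bigr => x _; rewrite /character pairing0 mulr1.
have total : \sum_(z : k.-tuple letter) walsh k f z ^+ 2 =
    m (true, false) + m (false, true) + m (true, true) + W.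
  transitivity (mass k f predT) => //.
  rewrite (@mass_disjoint _ _ predT box (predC box)); last 2 first.
  - by move=> z /=; rewrite orbN.
  - by move=> z /=; rewrite andbN.
  congr (_ + _); rewrite -[RHS]add0r -m0 /m /mass.
  rewrite (big_mkcond (fun z : k.-tuple _ => box z)).

  rewrite !(big_mkcond (fun z : k.-tuple _ => cls _ z)) -!big_split /=.
  apply: eq_bigr => z _; rewrite /cls; case: (box z) => /=; last by rewrite !addr0.
  by case: last_nonzero => [] [] [] /=; rewrite ?addr0 ?add0r.
rewrite total.
have -> : \sum_g (4 ^ k)%:R * energy k f g =
    D (false, None) + D (true, None) + D (false, Some false) + D (true, Some false)
    + D (false, Some true) + D (true, Some true).
  transitivity (\sum_a \sum_b D (a, b)); first by rewrite pair_bigA; apply: eq_bigr => -[].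
  rewrite big_bool /=.
  have opt (G : option bool -> R) :
      \sum_o G o = G None + G (Some true) + G (Some false).
    rewrite (bigD1 None) //= (bigD1 (Some true)) //= (bigD1 (Some false)) //=.
    by rewrite big1 ?addr0 ?addrA // => -[[]|].
  by rewrite !opt; ring.
(* Let C be the mass of [(true, true)], S the sum of the masses of the two unit classes, and omit
   the matrix energies. The shifts add up to 2 C <= S/2 + 3 W and the shears to S <= 3 C + 3 W, so C
   <= 9 W, S <= 30 W and the total is at most 40 W. The matrix energies enter with coefficients 15
   and 24. *)
have := shift false; have := shift true; have := shear false; have := shear true.
rewrite /=.
have := D0 (false, None); have := D0 (true, None).
have := D0 (false, Some false); have := D0 (true, Some false).
have := D0 (false, Some true); have := D0 (true, Some true).
lra.
Qed.

End Walsh.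

(** * Removing a free face of a geometric complex *)

Section Geometry.
Local Open Scope ring_scope.
Local Open Scope classical_set_scope.
Variable R : realType.

Definition std_face N (P : pred 'I_N) : set 'rV[R]_N :=
  [set x | [/\ forall j, 0 <= x 0 j, \sum_j x 0 j = 1 &
               forall j, ~~ P j -> x 0 j = 0]].

Lemma sum_nth_seq (T : zmodType) (U : zmodType) (s : seq T) (H : T -> U) :
  \sum_(i < size s) H s`_i = \sum_(y <- s) H y.
Proof. by rewrite (big_nth 0) big_mkord. Qed.

Lemma hull_sub_std_face N (s : seq 'rV[R]_N) (P : pred 'I_N) :
  (forall y, y \in s -> std_face P y) -> hull s `<=` std_face P.
Proof.
move=> sP x [t [t0 t1] ->].
have sP' (i : 'I_(size s)) : std_face P s`_i by apply/sP/mem_nth.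
have coordE j : (\sum_i t i *: s`_i) 0 j = \sum_i t i * (s`_i) 0 j.
  by rewrite summxE; apply: eq_bigr => i _; rewrite mxE.
split.
- move=> j; rewrite coordE; apply: sumr_ge0 => i _.
  by apply: mulr_ge0 => //; case: (sP' i).
- under eq_bigr do rewrite coordE.
  rewrite exchange_big -[RHS]t1; apply: eq_bigr => i _.
  by rewrite -mulr_sumr; case: (sP' i) => _ -> _; rewrite mulr1.
- move=> j Pj; rewrite coordE big1 // => i _.
  by case: (sP' i) => _ _ ->; rewrite ?mulr0.
Qed.

Lemma std_face_delta N (P : pred 'I_N) i : P i -> std_face P (delta_mx 0 i).
Proof.
move=> Pi; split.
- by move=> j; rewrite mxE eqxx; case: eqP.
- rewrite (bigD1 i) //= big1 => [|j /negbTE ji]; rewrite mxE ?eqxx ?addr0 //.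
  by rewrite ji.
- by move=> j Pj; rewrite mxE eqxx; case: eqP => // ji; rewrite ji Pi in Pj.
Qed.

Lemma sum_uniq_support (U : zmodType) (I : finType) (s : seq I) (G : I -> U) :
  uniq s -> (forall j, j \notin s -> G j = 0) ->
  \sum_(j <- s) G j = \sum_j G j.
Proof.
move=> us G0; rewrite big_uniq // [RHS](bigID (mem s)) /=.
by rewrite [X in _ + X]big1 ?addr0.
Qed.

Lemma hull_std_face N (s : seq 'I_N) : uniq s ->
  hull [seq delta_mx 0 j | j <- s] = std_face (mem s).
Proof.
move=> us; apply/seteqP; split.
  by apply: hull_sub_std_face => y /mapP[j js ->]; exact: std_face_delta.
move=> x [x0 x1 xs]; set l := map _ _.
(* The scalar product with [x] reads the barycentric weight off the vertex itself, so no index in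
   the list has to be tracked. *)
pose w (y : 'rV[R]_N) := \sum_j x 0 j * y 0 j.
have wE j : w (delta_mx 0 j) = x 0 j.
  rewrite /w (bigD1 j) //= big1 => [|i /negbTE ji]; rewrite mxE ?eqxx ?addr0 ?mulr1 //.
  by rewrite ji mulr0.
have xs' j : j \notin s -> x 0 j = 0 by exact: xs.
exists (fun i => w l`_i).
  split.
    move=> i; have /mapP[j _ ->] : l`_i \in l by exact: mem_nth.
    by rewrite wE.
  rewrite (sum_nth_seq l w) big_map (eq_bigr (x 0)) => [|j _]; last exact: wE.
  by rewrite sum_uniq_support.
rewrite (sum_nth_seq l (fun y => w y *: y)) big_map.
rewrite (eq_bigr (fun j => x 0 j *: delta_mx 0 j)) => [|j _]; last by rewrite wE.
rewrite sum_uniq_support // => [|j /xs' ->]; last by rewrite scale0r.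
exact: row_sum_delta.
Qed.

Lemma std_simplexE n : @std_simplex R n = std_face predT.
Proof. by apply/seteqP; split => x; case=> h1 h2; split. Qed.

Lemma std_simplex_hull n :
  @std_simplex R n = hull [seq delta_mx 0 j | j <- enum 'I_n.+1].
Proof.
rewrite hull_std_face ?enum_uniq // std_simplexE; congr std_face.
by apply/funext => j; rewrite /= mem_enum.
Qed.

Definition face_param n N (i : 'I_n.+1 -> 'I_N) (x : 'rV[R]_n.+1) : 'rV[R]_N :=
  \sum_j x 0 j *: delta_mx 0 (i j).

Lemma face_param_affine n N (i : 'I_n.+1 -> 'I_N) (I : finType) (t : I -> R) y :
  face_param i (\sum_k t k *: y k) = \sum_k t k *: face_param i (y k).
Proof.
rewrite /face_param; under [RHS]eq_bigr do rewrite scaler_sumr.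
rewrite exchange_big; apply: eq_bigr => j _.
rewrite summxE scaler_suml; apply: eq_bigr => k _.
by rewrite mxE scalerA.
Qed.

Lemma face_param_coord n N (i : 'I_n.+1 -> 'I_N) x j :
  injective i -> face_param i x 0 (i j) = x 0 j.
Proof.
move=> ii; rewrite /face_param summxE (bigD1 j) //= big1 => [|k /negbTE kj].
  by rewrite !mxE !eqxx mulr1 addr0.
by rewrite !mxE (inj_eq ii) [j == k]eq_sym kj andbF mulr0.
Qed.

Lemma face_param_out n N (i : 'I_n.+1 -> 'I_N) x k :
  k \notin codom i -> face_param i x 0 k = 0.
Proof.
move=> ki; rewrite /face_param summxE big1 // => j _; rewrite !mxE.
have -> : (k == i j) = false by apply: contraNF ki => /eqP ->; exact: codom_f.
by rewrite andbF mulr0.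
Qed.

Lemma PL_homeo_face n N (i : 'I_n.+1 -> 'I_N) : injective i ->
  PL_homeo (@std_simplex R n) (std_face (mem (codom i))) (face_param i).
Proof.
move=> ii; split.
  exists [:: [seq delta_mx 0 j | j <- enum 'I_n.+1]].
    by rewrite std_simplex_hull; apply/seteqP; split => [x hx|x [s /=]];
      [exists (map (delta_mx 0) (enum 'I_n.+1)); rewrite //= inE
      | rewrite inE => /eqP ->].
  by move=> s _ t _; rewrite face_param_affine.
have sumE (y : 'rV[R]_N) : (forall k, k \notin codom i -> y 0 k = 0) ->
    \sum_k y 0 k = \sum_j y 0 (i j).
  move=> y0; rewrite -(@sum_uniq_support _ _ (codom i)) //.
    by rewrite big_map big_enum.
  by rewrite map_inj_uniq ?enum_uniq.
split.
- move=> x [x0 x1]; split.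
  + move=> k; have [/codomP[j ->]|/face_param_out -> //] := boolP (k \in codom i).
    by rewrite face_param_coord.
  + rewrite sumE => [|k /face_param_out //]; rewrite -[RHS]x1.
    by apply: eq_bigr => j _; rewrite face_param_coord.
  + by move=> k; exact: face_param_out.
- move=> x y _ _ xy; apply/rowP => j.
  by rewrite -(face_param_coord x j ii) xy face_param_coord.
- move=> y [y0 y1 yi]; exists (\row_j y 0 (i j)).
    by split => [j|]; rewrite ?mxE // -[RHS]y1 sumE //; apply: eq_bigr => j _; rewrite mxE.
  apply/rowP => k.
  have [/codomP[j ->]|ki] := boolP (k \in codom i).
    by rewrite face_param_coord // mxE.
  by rewrite face_param_out // yi.
Qed.

(** The segment is bent at its midpoint, which goes to the vertex [v], while its ends go to [b] and
    [c]. Positive parts and a minimum put the two linear halves into one formula. *)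
Definition fold_edge N (b v c : 'I_N) (x : 'rV[R]_2) : 'rV[R]_N :=
  Num.max (x 0 0 - x 0 1) 0 *: delta_mx 0 b
  + (2 * Num.min (x 0 0) (x 0 1)) *: delta_mx 0 v
  + Num.max (x 0 1 - x 0 0) 0 *: delta_mx 0 c.

Lemma ord2_cases (i : 'I_2) : i = 0 \/ i = 1.
Proof. by case: i => [[|[|//]] h]; [left|right]; apply/val_inj. Qed.

Lemma std_simplex1P (x : 'rV[R]_2) :
  std_simplex x <-> [/\ 0 <= x 0 0, 0 <= x 0 1 & x 0 0 + x 0 1 = 1].
Proof.
have e2 : \sum_i x 0 i = x 0 0 + x 0 1.
  by rewrite big_ord_recl big_ord1; congr (_ + x _ _); apply/val_inj.
split=> [[x0]|[x0 x1 xs]]; first by rewrite e2 => <-; split.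
split; last by rewrite e2.
by move=> i; case: (ord2_cases i) => ->.
Qed.

Lemma hull2P N (y z : 'rV[R]_N) x :
  hull [:: y; z] x <-> exists a b : R, [/\ 0 <= a, 0 <= b, a + b = 1 & x = a *: y + b *: z].
Proof.
split=> [[t [t0 t1] ->]|[a [b [a0 b0 ab ->]]]].
  exists (t ord0), (t (lift ord0 ord0)); split => //.
    by rewrite -t1 big_ord_recl big_ord1.
  by rewrite big_ord_recl big_ord1.
exists (fun i : 'I_2 => if i == ord0 then a else b).
  split=> [i|]; first by case: ifP.
  by rewrite big_ord_recl big_ord1.
by rewrite big_ord_recl big_ord1.
Qed.

Lemma row2P (T : Type) (x y : 'rV[T]_2) :
  x 0 0 = y 0 0 -> x 0 1 = y 0 1 -> x = y.
Proof.
move=> e0 e1; apply/rowP => j.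
by case: (ord2_cases j) => ->.
Qed.

Lemma PL_homeo_fold N (b v c : 'I_N) : b != v -> c != v -> b != c ->
  PL_homeo (@std_simplex R 1)
    (std_face (pred2 b v) `|` std_face (pred2 c v)) (fold_edge b v c).
Proof.
move=> bv cv bc.
pose mid : 'rV[R]_2 := const_mx (1 / 2).
have foldE x j : fold_edge b v c x 0 j =
    Num.max (x 0 0 - x 0 1) 0 * (j == b)%:R
    + (2 * Num.min (x 0 0) (x 0 1)) * (j == v)%:R
    + Num.max (x 0 1 - x 0 0) 0 * (j == c)%:R.
  by rewrite /fold_edge !mxE.
have cb : (c == b) = false by rewrite eq_sym (negbTE bc).
have foldb x : fold_edge b v c x 0 b = Num.max (x 0 0 - x 0 1) 0.
  by rewrite foldE eqxx (negbTE bv) (negbTE bc) /= !mulr0 mulr1 !addr0.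
have foldc x : fold_edge b v c x 0 c = Num.max (x 0 1 - x 0 0) 0.
  by rewrite foldE eqxx (negbTE cv) cb /= !mulr0 mulr1 !add0r.
have fold_left (x : 'rV[R]_2) : x 0 1 <= x 0 0 ->
    fold_edge b v c x = (x 0 0 - x 0 1) *: delta_mx 0 b + (2 * x 0 1) *: delta_mx 0 v.
  move=> h; rewrite /fold_edge max_l ?subr_ge0 // min_r // max_r ?subr_le0 //.
  by rewrite scale0r addr0.
have fold_right (x : 'rV[R]_2) : x 0 0 <= x 0 1 ->
    fold_edge b v c x = (x 0 1 - x 0 0) *: delta_mx 0 c + (2 * x 0 0) *: delta_mx 0 v.
  move=> h; rewrite /fold_edge max_r ?subr_le0 // min_l // max_l ?subr_ge0 //.
  by rewrite scale0r add0r addrC.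
have face2 (u w : 'I_N) (p q : R) : 0 <= p -> 0 <= q -> p + q = 1 ->
    std_face (pred2 u w) (p *: delta_mx 0 u + q *: delta_mx 0 w).
  move=> p0 q0 pq; apply: (@hull_sub_std_face _ [:: delta_mx 0 u; delta_mx 0 w]).
    move=> y; rewrite !inE => /orP[] /eqP ->; apply: std_face_delta;
      by rewrite /= eqxx ?orbT.
  by apply/hull2P; exists p, q.
have face2E (u w : 'I_N) (y : 'rV[R]_N) : u != w -> std_face (pred2 u w) y ->
    [/\ 0 <= y 0 u, 0 <= y 0 w, y 0 u + y 0 w = 1 &
        y = y 0 u *: delta_mx 0 u + y 0 w *: delta_mx 0 w].
  move=> uw [y0 y1 yo]; split => //.
    rewrite -[RHS]y1 (bigD1 u) //= (bigD1 w) /=; last by rewrite eq_sym.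
    by rewrite big1 ?addr0 // => j /andP[ju jw]; rewrite yo //= negb_or ju.
  apply/rowP => j; rewrite !mxE /=.
  have [->|ju] := eqVneq j u; first by rewrite (negbTE uw) mulr0 mulr1 addr0.
  have [->|jw] := eqVneq j w; first by rewrite mulr0 mulr1 add0r.
  by rewrite !mulr0 addr0 yo //= negb_or ju.
split.
  exists [:: [:: delta_mx 0 0; mid]; [:: delta_mx 0 1; mid]].
    apply/seteqP; split => x.
      move=> /std_simplex1P [x0 x1 x01].
      have [h|h] := lerP (x 0 1) (x 0 0).
        exists [:: delta_mx 0 0; mid]; first by rewrite /= inE eqxx.
        apply/hull2P; exists (x 0 0 - x 0 1), (2 * x 0 1).
        by split; [lra|lra|lra|apply: row2P; rewrite !mxE /=; lra].
      exists [:: delta_mx 0 1; mid]; first by rewrite /= !inE eqxx orbT.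
      apply/hull2P; exists (x 0 1 - x 0 0), (2 * x 0 0).
      by split; [lra|lra|lra|apply: row2P; rewrite !mxE /=; lra].
    move=> [s /=]; rewrite !inE => /orP[] /eqP -> /hull2P[p [q [p0 q0 pq ->]]];
      by apply/std_simplex1P; split; rewrite !mxE /=; lra.
  move=> s; rewrite !inE => /orP[] /eqP -> t [t0 t1].
    have := t1; have := t0 ord0; have := t0 (lift ord0 ord0).
    rewrite !big_ord_recl !big_ord0 /= !addr0.
    set p := t _; set q := t _ => q0 p0 pq.
    rewrite !fold_left !mxE /=; last 3 first.
    - lra.
    - lra.
    - lra.
    by apply/rowP => j; rewrite !mxE /=; lra.
  have := t1; have := t0 ord0; have := t0 (lift ord0 ord0).
  rewrite !big_ord_recl !big_ord0 /= !addr0.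
  set p := t _; set q := t _ => q0 p0 pq.
  rewrite !fold_right !mxE /=; last 3 first.
  - lra.
  - lra.
  - lra.
  by apply/rowP => j; rewrite !mxE /=; lra.
split.
- move=> x /std_simplex1P [x0 x1 x01].
  have [h|h] := lerP (x 0 1) (x 0 0).
    by left; rewrite fold_left //; apply: face2; lra.
  by right; rewrite fold_right ?ltW //; apply: face2; lra.
- move=> x y /set_mem/std_simplex1P[x0 x1 x01] /set_mem/std_simplex1P[y0 y1 y01] xy.
  (* The [b] and [c] coordinates of the image are the positive and negative parts of this
     difference. *)
  have hb : x 0 0 - x 0 1 = y 0 0 - y 0 1.
    have := foldb x; have := foldc x; rewrite xy foldb foldc.
    by rewrite /Num.max; do 4 case: ifP; lra.
  by apply: row2P; lra.
- move=> y [] /face2E => [/(_ bv)|/(_ cv)] [y1 y2 y12 ->].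
    (* The weight of [v] is shared equally, since [v] is the image of the midpoint. *)
    exists (\row_j if j == 0 then y 0 b + y 0 v / 2 else y 0 v / 2).
      by apply/std_simplex1P; rewrite !mxE /=; split; lra.
    rewrite fold_left !mxE /=; last by lra.
    by congr (_ *: _ + _ *: _); lra.
  exists (\row_j if j == 0 then y 0 v / 2 else y 0 c + y 0 v / 2).
    by apply/std_simplex1P; rewrite !mxE /=; split; lra.
  rewrite fold_right !mxE /=; last by lra.
  by congr (_ *: _ + _ *: _); lra.
Qed.

(** * Geometric complexes and elementary collapses through free faces *)

Section Complexes.
Variable V : finType.
Implicit Types (K : {set {set V}}) (s t : {set V}) (u v : V).

Definition simplex s : set 'rV[R]_#|V| := std_face (fun j => enum_val j \in s).

Definition polytopes K : set 'rV[R]_#|V| := \bigcup_(s in [set` K]) simplex s.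

Definition closed_faces K : Prop :=
  finset.set0 \notin K /\
  forall s t, s \in K -> t \subset s -> t != finset.set0 -> t \in K.

Lemma simplex_hull s : simplex s = hull [seq delta_mx 0 (enum_rank v) | v <- enum s].
Proof.
rewrite (map_comp (delta_mx 0) enum_rank) hull_std_face.
  congr std_face; apply/funext => j; rewrite -{2}[j]enum_valK /=.
  by rewrite mem_map ?mem_enum //; exact: enum_rank_inj.
by rewrite map_inj_uniq ?enum_uniq //; exact: enum_rank_inj.
Qed.

Lemma polyhedron_polytopes K : polyhedron (polytopes K).
Proof.
exists [seq [seq delta_mx 0 (enum_rank v) | v <- enum (s : {set V})] | s <- enum K].
apply/seteqP; split => x.
  move=> [s sK xs]; exists [seq delta_mx 0 (enum_rank v) | v <- enum s].
    by apply/mapP; exists s; rewrite ?mem_enum.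
  by rewrite -simplex_hull.
move=> [l /mapP[s + ->]]; rewrite mem_enum -simplex_hull => sK xs.
by exists s.
Qed.

Definition support (x : 'rV[R]_#|V|) : {set V} := [set v | x 0 (enum_rank v) != 0]%SET.

Lemma simplexP s x : simplex s x <->
  [/\ forall j, 0 <= x 0 j, \sum_j x 0 j = 1 & support x \subset s].
Proof.
split=> [] [x0 x1 xs]; split => //.
  apply/fintype.subsetP => v; rewrite inE; apply: contraR => vs.
  by rewrite xs // enum_rankK.
move=> j; apply: contraNeq => xj; apply: (fintype.subsetP xs).
by rewrite inE enum_valK.
Qed.

(** The support is the smallest face containing a point; this reduces unions and intersections of
    polyhedra to membership of one set in [K]. *)
Lemma polytopesP K x : closed_faces K -> polytopes K x <->
  [/\ forall j, 0 <= x 0 j, \sum_j x 0 j = 1 & support x \in K].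
Proof.
move=> [K0 Ks]; split.
  move=> [s sK /simplexP[x0 x1 xs]]; split => //; apply: Ks xs _ => //.
  apply/eqP => supp0; have /eqP := oner_neq0 R; apply; rewrite -x1 big1 // => j _.
  apply/eqP; have /setP/(_ (enum_val j)) := supp0.
  by rewrite !inE enum_valK => /negbFE.
by move=> [x0 x1 xK]; exists (support x) => //; apply/simplexP.
Qed.

(** The second clause serves the condition in [disk_face] that the face lie in the boundary of the
    disk. *)
Lemma simplex_disk n s : #|s| = n.+1 ->
  exists2 f, PL_homeo (@std_simplex R n) (simplex s) f &
    forall x u, simplex s x -> u \in s -> x 0 (enum_rank u) = 0 ->
      (f @` @std_simplex_boundary R n) x.
Proof.
move=> sn.
pose i (j : 'I_n.+1) := enum_rank (enum_val (cast_ord (esym sn) j)).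
have ii : injective i by move=> j k /enum_rank_inj/enum_val_inj/cast_ord_inj.
have iE : (fun j => enum_val j \in s) = mem (codom i) :> pred 'I_#|V|.
  apply/funext => j; apply/idP/codomP => [js|[k ->]].
    exists (cast_ord sn (enum_rank_in js (enum_val j))).
    by rewrite /i cast_ordK enum_rankK_in // enum_valK.
  by rewrite /i enum_rankK enum_valP.
have h := PL_homeo_face ii; rewrite /simplex iE.
exists (face_param i) => // x u xs us xu.
case: h => _ [_ _ /(_ x xs)[y ys yx]].
exists y => //; split => //.
have : enum_rank u \in codom i by have := congr1 (@^~ (enum_rank u)) iE; rewrite /= enum_rankK us.
move=> /codomP[j uj]; exists j.
by rewrite -(face_param_coord y j ii) yx -uj.
Qed.

(* Removing a free face t of the simplex v |: t leaves the union of the other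
   facets of v |: t, a PL disk only exhibited here for dimensions 0 and 1. *)
Lemma facets_disk v t : v \notin t -> (#|t| = 1 \/ #|t| = 2)%N ->
  PL_disk #|t|.-1 (\bigcup_(u in [set` t]) simplex ((v |: t) :\ u)).
Proof.
move=> vt [] tn; rewrite tn /=.
  move/eqP/cards1P: tn => [u tu]; rewrite {}tu in vt *.
  have -> : \bigcup_(w in [set` [set u]%SET]) simplex ((v |: [set u]) :\ w)%SET =
            simplex [set v]%SET.
    have e : ((v |: [set u]) :\ u = [set v])%SET.
      by rewrite finset.setUC finset.setU1K // !inE eq_sym -finset.in_set1.
    apply/seteqP; split => [x [w /=]|x xv]; first by rewrite inE => /eqP ->; rewrite e.
    by exists u; rewrite /= ?inE // e.
  by case: (@simplex_disk 0 [set v]%SET); rewrite ?cards1 // => f hf _; exists f.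
move/eqP/cards2P: tn => [b [c [bc tE]]]; rewrite {}tE in vt *.
move: vt; rewrite !inE negb_or => /andP[vb vc].
exists (fold_edge (enum_rank c) (enum_rank v) (enum_rank b)).
have er := inj_eq (@enum_rank_inj V).
have simp2 a : simplex [set a; v]%SET = std_face (pred2 (enum_rank a) (enum_rank v)).
  congr std_face; apply/funext => j.
  by rewrite !inE /= -!er enum_valK.
have eb : ((v |: [set b; c]) :\ b = [set c; v])%SET.
  apply/setP => w; rewrite !inE.
  have [->|wb] := eqVneq w b; first by rewrite (eq_sym b v) (negbTE bc) (negbTE vb).
  by rewrite /= orbC.
have ec : ((v |: [set b; c]) :\ c = [set b; v])%SET.
  apply/setP => w; rewrite !inE.
  have [->|wc] := eqVneq w c.
    by rewrite (eq_sym c b) (eq_sym c v) (negbTE bc) (negbTE vc).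
  by rewrite /= orbF orbC.
have -> : \bigcup_(u in [set` [set b; c]%SET]) simplex ((v |: [set b; c]) :\ u)%SET =
   std_face (pred2 (enum_rank c) (enum_rank v)) `|`
   std_face (pred2 (enum_rank b) (enum_rank v)).
  rewrite -!simp2; apply/seteqP; split => x.
    by move=> [u /=]; rewrite !inE => /orP[] /eqP ->; rewrite ?eb ?ec; [left|right].
  by move=> [] xs; [exists b|exists c]; rewrite /= ?inE ?eqxx ?orbT // ?eb ?ec.
by apply: PL_homeo_fold; rewrite er // eq_sym.
Qed.

Lemma free_face_collapse K v t :
  closed_faces K -> t \in K -> v |: t \in K -> v \notin t ->
  (#|t| = 1 \/ #|t| = 2)%N ->
  (forall r, r \in K -> t \subset r -> r = t \/ r = v |: t) ->
  closed_faces (K :\ t :\ (v |: t)) /\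
  elementary_collapse (polytopes K) (polytopes (K :\ t :\ (v |: t))).
Proof.
move=> Kc tK sK vt tn free; set s := (v |: t)%SET; set L := (_ :\ _)%SET.
have Lc : closed_faces L.
  case: (Kc) => K0 Ks; split; first by rewrite !inE (negbTE K0) !andbF.
  move=> r q; rewrite !inE => /and3P[rs rt rK] qr q0; rewrite (Ks _ _ rK qr q0) andbT.
  by apply/andP; split; apply: contraNneq rs => qE; move: qr; rewrite qE;
    [move=> sr; have {}sr : t \subset r by apply: fintype.subset_trans sr; exact: subsetU1
    |move=> sr]; case: (free _ rK sr) => [rE|->//]; rewrite rE eqxx in rt.
split=> //; split; first exact: polyhedron_polytopes.
have t1 : #|t| = #|t|.-1.+1 by case: tn => ->.
have sn : #|s| = #|t|.-1.+2 by rewrite cardsU1 vt -t1 add1n.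
have [f hf fb] := simplex_disk sn.
(* The only faces over [t] are the two removed ones, so a point left in [simplex s] has a support
   missing some vertex of [t]. *)
have LD : polytopes L `&` simplex s = \bigcup_(u in [set` t]) simplex (s :\ u).
  apply/seteqP; split => x.
    move=> [/(polytopesP _ Lc)[x0 x1 xL] /simplexP[_ _ xs]].
    have [tx|/subsetPn[u ut ux]] := boolP (t \subset support x).
      move: xL; rewrite !inE => /and3P[ns nt xK].
      by case: (free _ xK tx) => xE; rewrite xE eqxx in ns nt.
    by exists u => //; apply/simplexP; split => //; rewrite subsetD1 xs ux.
  move=> [u /= ut /simplexP[x0 x1]]; rewrite subsetD1 => /andP[xs ux]; split.
    apply/(polytopesP _ Lc); split => //; rewrite !inE.
    have /(polytopesP _ Kc)[_ _ ->] : polytopes K x by exists s => //; apply/simplexP.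
    rewrite andbT; apply/andP; split; apply: contraNneq ux => ->; rewrite ?ut //.
    by rewrite !inE ut orbT.
  exact/simplexP.
exists #|t|.-1, (simplex s); split.
- by exists f.
- apply/seteqP; split => x.
    move=> /(polytopesP _ Kc)[x0 x1 xK].
    have [xs|xs] := boolP (support x \subset s); first by right; apply/simplexP.
    left; apply/(polytopesP _ Lc); split => //; rewrite !inE xK andbT.
    apply/andP; split; apply: contraNneq xs => -> //; exact: subsetU1.
  move=> [|xs]; last by exists s.
  move=> /(polytopesP _ Lc)[x0 x1 xL]; apply/(polytopesP _ Kc); split => //.
  by move: xL; rewrite !inE => /and3P[].
- rewrite LD; split; first exact: facets_disk.
  exists f => //; move=> x [u /= ut /simplexP[x0 x1]]; rewrite subsetD1 => /andP[xs ux].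
  apply: (fb x u); first exact/simplexP.
    by rewrite !inE ut orbT.
  by apply/eqP; move: ux; rewrite inE => /negbNE.
Qed.

End Complexes.
End Geometry.

(** * Collapsing along apices *)

Section ApexCollapse.
Local Open Scope nat_scope.
Variables (R : realType) (V : finType) (ord : V -> nat) (par : V -> V) (root : V).
Hypothesis ord_inj : injective ord.
Hypothesis ord_root : forall v, v != root -> ord root < ord v.
Hypothesis ord_par : forall v, v != root -> ord (par v) < ord v.
Implicit Types (s t : {set V}) (K : {set {set V}}).

Definition top s : V :=
  odflt root [pick v in s | [forall w in s, ord w <= ord v]].

Definition apex s : V := par (top s).

Lemma topP s : s != finset.set0 -> top s \in s /\ forall w, w \in s -> ord w <= ord (top s).
Proof.
case/set0Pn => v0 v0s; rewrite /top; case: pickP => [v /andP[vs /forall_inP]|] //=.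
case: (arg_maxnP ord v0s) => v vs vmax /(_ v) /negP[].
by apply/andP; split; [exact: vs|exact/forall_inP].
Qed.

Lemma top_eq s v : v \in s -> (forall w, w \in s -> ord w <= ord v) -> top s = v.
Proof.
move=> vs vmax; have [ts tmax] := topP (introT (set0Pn s) (ex_intro _ v vs)).
by apply/ord_inj/eqP; rewrite eqn_leq vmax // tmax.
Qed.

Lemma top_neq_root s : s != finset.set0 -> s != [set root] -> top s != root.
Proof.
move=> s0 sr; apply: contraNneq sr => tr; have [ts tmax] := topP s0.
rewrite eqEcard cards1 card_gt0 s0 andbT; apply/fintype.subsetP => w /tmax.
by rewrite tr inE; apply: contraTT => /ord_root; rewrite -ltnNge.
Qed.

(** The apex is below the top vertex, so inserting or deleting it changes neither the top nor the
    apex: toggling the apex is an involution on faces. *)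
Lemma top_apexU s : s != finset.set0 -> s != [set root] -> top (apex s |: s) = top s.
Proof.
move=> s0 sr; have [ts tmax] := topP s0; apply: top_eq; first by rewrite inE ts orbT.
move=> w /setU1P[->|/tmax //]; exact/ltnW/ord_par/top_neq_root.
Qed.

Lemma top_apexD s : s != finset.set0 -> s != [set root] ->
  top s \in s :\ apex s /\ top (s :\ apex s) = top s.
Proof.
move=> s0 sr; have [ts tmax] := topP s0.
have tD : top s \in s :\ apex s.
  rewrite !inE ts andbT; apply/eqP => e.
  by have := ord_par (top_neq_root s0 sr); rewrite -/(apex s) -e ltnn.
by split=> //; apply: top_eq => // w /setD1P[_ /tmax].
Qed.

(** The size bound leaves only free faces with one or two vertices, the cases covered by
    [facets_disk]. *)
Definition apex_closed K : Prop :=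
  [/\ closed_faces K, [set root] \in K,
      forall s, s \in K -> s != [set root] -> apex s |: s \in K &
      forall s, s \in K -> #|s| <= 3].

(** The successor makes the weight strictly monotone for inclusion, even if some vertex has order
    0. *)
Definition weight s := \sum_(v in s) (ord v).+1.

(* Pairing s with its symmetric difference with [set apex s] is an acyclic
   matching; a lower face of maximal weight is free. *)
Lemma apex_free_face K : apex_closed K -> K != [set [set root]] ->
  exists t, [/\ t \in K, t != [set root], apex t \notin t &
    forall r, r \in K -> t \subset r -> r = t \/ r = apex t |: t].
Proof.
move=> [[K0 Ks] rK aK _] Kr.
have nz s : s \in K -> s != finset.set0 by apply: contraTneq => ->.
pose M := [set t in K | (t != [set root]) && (apex t \notin t)].
have lower s : s \in K -> s != [set root] -> s :\ apex s \in M.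
  move=> sK sr; have [ts tE] := top_apexD (nz _ sK) sr.
  have aE : apex (s :\ apex s) = apex s by rewrite {1}/apex tE.
  rewrite inE aE setD11 andbT; apply/andP; split.
    apply: (Ks s) => //; first exact: finset.subsetDl.
    by apply/set0Pn; exists (top s).
  apply: contraTneq ts => ->; rewrite inE; exact: top_neq_root (nz _ sK) sr.
have [s sK sr] : exists2 s, s \in K & s != [set root].
  apply/exists_inP; apply: contraNT Kr; rewrite negb_exists_in => /forall_inP h.
  apply/eqP/setP => s; rewrite inE; apply/idP/eqP => [/h/negPn/eqP //|-> //].
case: (arg_maxnP weight (lower s sK sr)) => t tM tmax.
have : t \in M by exact: tM.
rewrite inE => /and3P[tK tr ta].
exists t; split=> // r rK' tr'.
have rr : r != [set root].
  apply: contraNneq tr => rE; rewrite rE in tr'.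
  by rewrite eqEcard tr' cards1 card_gt0 nz.
have rM := lower _ rK' rr; have /= := tmax _ rM.
have [ts tE] := top_apexD (nz _ rK') rr.
have weightD (q : {set V}) v : v \in q -> weight q = (ord v).+1 + weight (q :\ v).
  by move=> vq; rewrite /weight (big_setD1 v).
have weightS (q1 q2 : {set V}) : q1 \subset q2 -> weight q1 <= weight q2.
  by move=> q12; rewrite /weight [X in _ <= X](big_setID q1) /= (finset.setIidPr q12) leq_addr.
(* If [t] contains [apex r], it omits [top r], as otherwise [apex t = apex r] would lie in [t]. Then
   [r :\ apex r] trades [apex r] for the heavier [top r] and outweighs [t]. In the other case [t] is
   contained in [r :\ apex r], and maximality forces equality. *)
have [art|art] := boolP (apex r \in t).
  rewrite leqNgt => /negP[].
  have arr := fintype.subsetP tr' _ art.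
  have ttr : top r \notin t.
    apply: contra ta => tt; rewrite {1}/apex (@top_eq t (top r)) // => w /(fintype.subsetP tr').
    by case: (topP (nz _ rK')) => _; apply.
  rewrite -(ltn_add2l (ord (apex r)).+1) -weightD //.
  rewrite (weightD r (top r)); last by case: (topP (nz _ rK')).
  rewrite -addSn leq_add //; first by rewrite ltnS; exact/ord_par/top_neq_root/rr/nz.
  by apply: weightS; rewrite subsetD1 tr' ttr.
have trD : t \subset r :\ apex r by rewrite subsetD1 tr' art.
rewrite leqNgt => wt.
have tE' : t = r :\ apex r.
  apply/eqP; rewrite finset.eqEsubset trD; apply: contraNT wt => /subsetPn[v vr vt].
  rewrite (weightD _ v vr) addSn ltnS.
  by apply: leq_trans (weightS t (r :\ apex r :\ v) _) (leq_addl _ _); rewrite subsetD1 trD.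
have aE : apex t = apex r by rewrite /apex {1}tE' tE.
rewrite aE {2}tE'; have [arr|arr] := boolP (apex r \in r); first by right; rewrite finset.setD1K.
by left; rewrite tE'; apply/eqP; rewrite finset.eqEsubset finset.subsetDl subsetD1 fintype.subxx arr.
Qed.

Lemma apex_closed_collapse K P : apex_closed K ->
  collapses P (@polytopes R V K) -> collapsible P.
Proof.
elim: {K}#|K| {-2}K (leqnn #|K|) => [|n IH] K Kn Kc PK.
  by case: Kc => _ + _ _; move: Kn; rewrite leqn0 cards_eq0 => /eqP ->; rewrite inE.
have [Kr|Kr] := eqVneq K [set [set root]].
  exists (delta_mx 0%R (enum_rank root)); move: PK.
  congr collapses; apply/seteqP; split => x.
    move=> [s /=]; rewrite Kr inE => /eqP ->; rewrite simplex_hull enum_set1 /=.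
    move=> [t [t0 t1]]; move: t t0 t1 => /= t t0; rewrite !big_ord1 /= => -> ->.
    by rewrite scale1r.
  move=> /= ->; exists [set root]%SET; first by rewrite /= Kr inE.
  by apply: std_face_delta; rewrite enum_rankK inE.
have [t [tK tr ta free]] := apex_free_face Kc Kr.
case: (Kc) => -[K0 Ks] rK aK K3.
have nz s : s \in K -> s != finset.set0 by apply: contraTneq => ->.
have atK := aK _ tK tr.
have t12 : (#|t| = 1 \/ #|t| = 2)%N.
  have := K3 _ atK; rewrite cardsU1 ta.
  have : 0 < #|t| by rewrite card_gt0 nz.
  by case: #|t| => [|[|[|]]] //; [left|right].
case: (@free_face_collapse R V K _ _ (conj K0 Ks) tK atK ta t12 free) => Lc el.
apply: (IH (K :\ t :\ (apex t |: t))); last exact: collapses_step PK el.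
  have h1 := cardsD1 t K; rewrite tK in h1.
  have h2 := cardsD1 (apex t |: t) (K :\ t).
  by rewrite -ltnS (leq_trans _ Kn) // h1 h2 add1n ltnS leq_addl.
have atr : apex t |: t != [set root].
  apply: contraNneq tr => e; rewrite eqEcard cards1 card_gt0 nz // andbT -e.
  exact: subsetU1.
split=> //.
- by rewrite !inE rK eq_sym atr eq_sym tr.
- move=> s; rewrite !inE => /and3P[sat st sK] sr; rewrite aK // andbT.
  have aE := top_apexU (nz _ sK) sr.
  (* If [apex s |: s] is the removed upper face, then [s] has the apex of [t] and is itself one of
     the removed faces; if it is [t], then [t] contains its own apex. *)
  apply/andP; split; apply/eqP => e.
    have ea : apex s = apex t by rewrite /apex -aE e top_apexU // nz.
    have [as_|as_] := boolP (apex s \in s).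
      by case/eqP: sat; rewrite -e; apply/esym/finset.setUidPr; rewrite finset.sub1set.
    by case/eqP: st; rewrite -(finset.setU1K as_) e ea finset.setU1K.
  by move: ta; rewrite /apex -{1}e aE -/(apex s) -e setU11.
- by move=> s; rewrite !inE => /and3P[_ _ /K3].
Qed.

End ApexCollapse.

(** * The tower complex *)

Section Tower.
Local Open Scope nat_scope.
Variable n : nat.
Definition word : predArgType := n.-bseq letter.
HB.instance Definition _ := Finite.on word.
Implicit Types (x y z : word) (s t : {set word}).

Definition wroot : word := insub_bseq n [::].
Definition wpar x : word := insub_bseq n (behead x).
Definition wmove g x : word := insub_bseq n (move g x).
Definition wchild x c : word := insub_bseq n (c :: x).

Lemma insub_bseqE (l : seq letter) : size l <= n -> insub_bseq n l = l :> seq letter.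
Proof. by move=> h; rewrite /insub_bseq val_insubd h. Qed.

Lemma wrootE : wroot = [::] :> seq letter.
Proof. exact: insub_bseqE. Qed.

Lemma wparE x : wpar x = behead x :> seq letter.
Proof. by rewrite insub_bseqE // size_behead (leq_trans (leq_pred _)) ?size_bseq. Qed.

Lemma wmoveE g x : wmove g x = move g x :> seq letter.
Proof. by rewrite insub_bseqE // size_move size_bseq. Qed.

Lemma wchildE x c : size x < n -> wchild x c = c :: x :> seq letter.
Proof. by move=> h; rewrite insub_bseqE. Qed.

Lemma wmoveK g : involutive (wmove g).
Proof. by move=> x; apply/val_inj; rewrite /= !wmoveE moveK. Qed.

Lemma wpar_move g x : wpar (wmove g x) = wmove g (wpar x).
Proof. by apply/val_inj; rewrite /= wparE !wmoveE wparE behead_move. Qed.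

Lemma wchildK x c : size x < n -> wpar (wchild x c) = x.
Proof. by move=> h; apply/val_inj; rewrite /= wparE wchildE. Qed.

Lemma size_wpar x : size (wpar x) = (size x).-1.
Proof. by rewrite wparE size_behead. Qed.

Lemma word_size0 x : (size x == 0) = (x == wroot).
Proof. by rewrite size_eq0 -val_eqE /= wrootE. Qed.

Lemma wpar_root : wpar wroot = wroot.
Proof. by apply/val_inj; rewrite /= wparE !wrootE. Qed.

Lemma wpar_child x : x != wroot -> exists2 c, size (wpar x) < n & x = wchild (wpar x) c.
Proof.
rewrite -word_size0 => x0; have [c [l xE]] : exists c l, x = c :: l :> seq letter.
  by case: (x : seq letter) x0 => // c l _; exists c, l.
have h : size (wpar x) < n by rewrite wparE xE /= (leq_trans _ (size_bseq x)) // xE.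
by exists c => //; apply/val_inj; rewrite /= wchildE // wparE xE.
Qed.

(** Levels are compared first, so parents precede children; the arbitrary enumeration breaks ties
    inside a level. *)
Definition word_ord x : nat := size x * #|word| + enum_rank x.

Lemma word_ord_size x y : size x < size y -> word_ord x < word_ord y.
Proof.
move=> h; apply: (@leq_trans ((size x).+1 * #|word|)).
  by rewrite /word_ord mulSn [X in _ < X]addnC ltn_add2l ltn_ord.
by rewrite (leq_trans _ (leq_addr _ _)) // leq_mul2r h orbT.
Qed.

Lemma word_ord_inj : injective word_ord.
Proof.
move=> x y e; have sxy : size x = size y.
  by case: (ltngtP (size x) (size y)) => // /word_ord_size; rewrite e ltnn.
by move: e; rewrite /word_ord sxy => /addnI/ord_inj/enum_rank_inj.
Qed.

Lemma word_ord_root x : x != wroot -> word_ord wroot < word_ord x.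
Proof. by move=> h; apply: word_ord_size; rewrite wrootE lt0n word_size0. Qed.

Lemma word_ord_par x : x != wroot -> word_ord (wpar x) < word_ord x.
Proof.
by move=> h; apply: word_ord_size; rewrite size_wpar prednK // lt0n word_size0.
Qed.

Definition hadj x y := (x != y) && [exists g, y == wmove g x].

Lemma hadj_sym x y : hadj x y -> hadj y x.
Proof.
case/andP=> xy /existsP[g /eqP yE]; rewrite /hadj eq_sym xy.
by apply/existsP; exists g; rewrite yE wmoveK.
Qed.

(* Each horizontal edge is oriented, to select one diagonal of the square
   joining it to the edge of the parents. *)
Definition hle x y := (x == y) || hadj x y && (word_ord y < word_ord x).

Lemma hle_refl x : hle x x.
Proof. by rewrite /hle eqxx. Qed.

Lemma hle_ord x y : hle x y -> word_ord y <= word_ord x.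
Proof. by case/orP=> [/eqP ->|/andP[_ /ltnW]]. Qed.

Lemma hle_move x y : hle x y -> x = y \/ exists g, y = wmove g x.
Proof. by case/orP=> [/eqP ->|/andP[/andP[_ /existsP[g /eqP ->]] _]]; [left|right; exists g]. Qed.

Lemma hle_total x y g : y = wmove g x -> hle x y \/ hle y x.
Proof.
move=> yE; have [->|xy] := eqVneq x y; first by left; exact: hle_refl.
have h : hadj x y by rewrite /hadj xy; apply/existsP; exists g; rewrite yE.
case: (ltngtP (word_ord x) (word_ord y)) => [o|o|/word_ord_inj e].
- by right; rewrite /hle (hadj_sym h) o orbT.
- by left; rewrite /hle h o orbT.
- by rewrite e eqxx in xy.
Qed.

Lemma hle_size x y : hle x y -> size x = size y.
Proof. by case/hle_move => [-> //|[g ->]]; rewrite wmoveE size_move. Qed.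

Lemma hle_par x y : hle x y -> hle (wpar x) (wpar y) \/ hle (wpar y) (wpar x).
Proof.
case/hle_move => [->|[g ->]]; first by left; exact: hle_refl.
by apply: (@hle_total _ _ g); rewrite wpar_move.
Qed.

(** The chosen diagonal joins [y] to [wpar x]. Since [hle] is reflexive, vertical edges and single
    vertices arise from degenerate squares. *)
Definition tower_faces : {set {set word}} :=
  [set s | (s != finset.set0) && [exists x, exists y, hle x y &&
    ((s \subset [set x; y; wpar x]) || (s \subset [set y; wpar x; wpar y]))]].

Lemma tower_faceP s : reflect
  (s != finset.set0 /\ exists x y, hle x y /\
    (s \subset [set x; y; wpar x] \/ s \subset [set y; wpar x; wpar y]))
  (s \in tower_faces).
Proof.
rewrite inE; apply: (iffP andP) => -[s0].
  by case/existsP=> x /existsP[y /andP[xy /orP h]]; split => //; exists x, y.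
move=> [x [y [xy h]]]; split=> //; apply/existsP; exists x; apply/existsP; exists y.
by rewrite xy; apply/orP.
Qed.

Lemma tower_neq0 : finset.set0 \notin tower_faces.
Proof. by rewrite inE eqxx. Qed.

Lemma tower_sub s t : s \in tower_faces -> t \subset s -> t != finset.set0 -> t \in tower_faces.
Proof.
case/tower_faceP=> _ [x [y [xy h]]] ts t0; apply/tower_faceP; split=> //.
by exists x, y; split => //; case: h => h; [left|right]; exact: fintype.subset_trans ts h.
Qed.

Lemma tower_triangle x y s : hle x y -> s != finset.set0 -> s \subset [set x; y; wpar x] ->
  s \in tower_faces.
Proof. by move=> xy s0 h; apply/tower_faceP; split=> //; exists x, y; split => //; left. Qed.

Lemma tower_vertex x : [set x] \in tower_faces.
Proof.
apply: (tower_triangle (hle_refl x)); last by rewrite finset.sub1set !inE eqxx.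
by apply/set0Pn; exists x; rewrite inE.
Qed.

Definition tower : simplicial_complex :=
  SimplicialComplex tower_neq0 tower_vertex tower_sub.

Lemma card_tower_face s : s \in tower_faces -> #|s| <= 3.
Proof.
have c3 a b c : #|[set a; b; c] : {set word}| <= 3.
  rewrite -finset.setUA cardsU1 cards2 -[3]/(1 + 2).
  by apply: leq_add; [case: (_ \notin _)|case: (_ != _)].
by case/tower_faceP=> _ [x [y [_ [] h]]]; exact: leq_trans (subset_leq_card h) (c3 _ _ _).
Qed.

(** If the top vertex of a face is [x], its parent stays in the upper triangle ([upper]); if it is
    [y] and the face lies in the lower triangle, so does [wpar y] ([diag]). A face containing
    neither is a vertex or horizontal edge one level down ([edge]). *)
Lemma tower_apex_closed : apex_closed word_ord wpar wroot tower_faces.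
Proof.
split.
- by split; [exact: tower_neq0|exact: tower_sub].
- exact: tower_vertex.
- move=> s sF sr.
  have s0 : s != finset.set0 by case/tower_faceP: sF.
  have tE := top_eq wroot (@word_ord_inj).
  have U0 v : v |: s != finset.set0 by apply/set0Pn; exists v; exact: setU11.
  have nroot x y : hle x y -> s \subset [set x; y] -> x != wroot.
    move=> /hle_size xy sxy; apply: contraNneq sr => xr.
    have yr : y = wroot by apply/eqP; rewrite -word_size0 -xy xr wrootE.
    rewrite xr yr finset.setUid in sxy.
    by rewrite eqEcard sxy cards1 card_gt0 s0.
  have upper x y : hle x y -> x \in s -> s \subset [set x; y; wpar x] -> x != wroot ->
      apex word_ord wpar wroot s |: s \in tower_faces.
    move=> xy xs sxy xr; rewrite /apex (tE s x) //.
      apply: (tower_triangle xy) => //; apply/fintype.subsetP => w /setU1P[->|/(fintype.subsetP sxy) //].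
      by rewrite !inE eqxx !orbT.
    move=> w /(fintype.subsetP sxy); rewrite !inE => /orP[/orP[]|] /eqP -> //.
      exact: hle_ord.
    exact/ltnW/word_ord_par.
  have edge x y : hle x y -> s \subset [set x; y] ->
      apex word_ord wpar wroot s |: s \in tower_faces.
    move=> xy sxy; have xr := nroot _ _ xy sxy.
    have [xs|xs] := boolP (x \in s).
      apply: (upper _ _ xy xs) => //; exact: fintype.subset_trans sxy (finset.subsetUl _ _).
    have sy : s = [set y].
      apply/eqP; rewrite eqEcard cards1 card_gt0 s0 andbT.
      apply/fintype.subsetP => w ws; move: (fintype.subsetP sxy _ ws); rewrite !inE.
      by case/orP => // /eqP wx; rewrite -wx ws in xs.
    apply: (upper _ _ (hle_refl y)); rewrite ?sy ?inE //.
      by rewrite finset.sub1set !inE eqxx.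
    by rewrite -word_size0 -(hle_size xy) word_size0.
  have diag x y : hle x y -> y \in s -> s \subset [set y; wpar x; wpar y] -> y != wroot ->
      apex word_ord wpar wroot s |: s \in tower_faces.
    move=> xy ys sxy yr; rewrite /apex (tE s y) //.
      apply/tower_faceP; split=> //; exists x, y; split=> //; right.
      apply/fintype.subsetP => w /setU1P[->|/(fintype.subsetP sxy) //].
      by rewrite !inE eqxx !orbT.
    have par_lt z : size z = size y -> word_ord (wpar z) <= word_ord y.
      move=> zy; apply/ltnW/word_ord_size; rewrite size_wpar zy prednK // lt0n.
      by rewrite word_size0.
    move=> w /(fintype.subsetP sxy); rewrite !inE => /orP[/orP[]|] /eqP -> //; apply: par_lt => //.
    exact: hle_size.
  have [_ [x [y [xy h]]]] := elimT (tower_faceP s) sF.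
  have [xr|xr] := eqVneq x wroot.
    have yr : y = wroot by apply/eqP; rewrite -word_size0 -(hle_size xy) xr wrootE.
    apply: (edge _ _ (hle_refl wroot)); rewrite xr yr wpar_root !finset.setUid in h *.
    by case: h.
  have yr : y != wroot by rewrite -word_size0 -(hle_size xy) word_size0.
  have [ys|ys] := boolP (y \in s); last first.
    case: h => h.
      have [xs|xs] := boolP (x \in s); first exact: upper xy xs h xr.
      apply: (edge _ _ (hle_refl (wpar x))); apply/fintype.subsetP => w ws.
      move: (fintype.subsetP h _ ws); rewrite !inE => /orP[/orP[]|-> //] /eqP e.
        by rewrite -e ws in xs.
      by rewrite -e ws in ys.
    (* Moves commute with reduction, so the parents are again comparable by [hle], possibly in the
       opposite direction. *)
    have h' : s \subset [set wpar x; wpar y].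
      apply/fintype.subsetP => w ws.
      move: (fintype.subsetP h _ ws); rewrite !inE -orbA => /or3P[/eqP e|->|->] //.
        by rewrite -e ws in ys.
      by rewrite orbT.
    by case: (hle_par xy) => xy'; apply: (edge _ _ xy') => //; rewrite finset.setUC.
  case: h => h; last exact: diag xy ys h yr.
  have [xs|xs] := boolP (x \in s); first exact: upper xy xs h xr.
  apply: (diag _ _ xy ys) => //; apply/fintype.subsetP => w ws.
  move: (fintype.subsetP h _ ws); rewrite !inE -orbA => /or3P[/eqP e|->|->] //.
    by rewrite -e ws in xs.
  by rewrite orbT.
- exact: card_tower_face.
Qed.

Lemma tower_collapsible (R : realType) : collapsible (@realization R tower).
Proof.
have -> : @realization R tower = @polytopes R word tower_faces.
  by rewrite /polytopes; apply: eq_bigcupr => s _; rewrite simplex_hull.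
by apply: (apex_closed_collapse word_ord_inj word_ord_root word_ord_par tower_apex_closed);
  exact: collapses_refl.
Qed.

End Tower.

(** * Degree and expansion *)

Section TowerGraph.
Local Open Scope nat_scope.
Variable n : nat.
Implicit Types (x y z : word n) (A s : {set word n}).
Local Notation root := (wroot n).
Local Notation graph_of := (one_skeleton (tower n)).

(** A list with possible repetitions, so that its length depends neither on the vertex nor on
    [n]. *)
Definition near x : seq (word n) :=
  [:: x; wpar x] ++ [seq wmove g x | g <- enum {: move_index}]
                 ++ [seq wchild x c | c <- enum {: letter}].

Lemma near_refl x : x \in near x.
Proof. by rewrite mem_cat inE eqxx. Qed.

Lemma near_par x : wpar x \in near x.
Proof. by rewrite mem_cat !inE eqxx orbT. Qed.

Lemma near_child x : x \in near (wpar x).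
Proof.
have [->|/wpar_child[c _ xE]] := eqVneq x root; first by rewrite wpar_root near_refl.
rewrite {1}xE !mem_cat; apply/orP; right; apply/orP; right.
by apply: map_f; rewrite mem_enum.
Qed.

Lemma near_move g x : wmove g x \in near x.
Proof.
rewrite !mem_cat; apply/orP; right; apply/orP; left.
by apply: map_f; rewrite mem_enum.
Qed.

Lemma near_hle x y : hle x y -> (x \in near y) && (y \in near x).
Proof.
case/hle_move => [->|[g ->]]; first by rewrite near_refl.
by rewrite near_move -{1}(wmoveK g x) near_move.
Qed.

(** A diagonal joins a vertex to the parent of a horizontal neighbour, which takes two steps; this
    is the source of the square in the degree bound. *)
Lemma near_triangle s x y : s \in tower_faces n -> x \in s -> y \in s ->
  exists2 z, z \in near x & y \in near z.
Proof.
have r := near_refl; have p := near_par; have c := near_child.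
case/tower_faceP=> _ [a [b [ab h]]] xs ys; have /andP[an bn] := near_hle ab.
have pab : (wpar a \in near (wpar b)) && (wpar b \in near (wpar a)).
  by case: (hle_par ab) => /near_hle // /andP[-> ->].
case/andP: pab => pa pb.
case: h => /fintype.subsetP h; move: (h _ xs) (h _ ys); rewrite !inE -!orbA;
  case/or3P=> /eqP -> /or3P[] /eqP ->;
  by [exists a|exists b|exists (wpar a)|exists (wpar b)].
Qed.

Lemma tower_degree (x : graph_of) : degree x <= (2 + (#|{: move_index}| + #|{: letter}|)) ^ 2.
Proof.
pose l := flatten [seq near z | z <- near x].
have near_size z : size (near z) = 2 + (#|{: move_index}| + #|{: letter}|).
  by rewrite !size_cat !size_map !cardE !enumT.
have -> : (2 + (#|{: move_index}| + #|{: letter}|)) ^ 2 = size l.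
  have gen (f : word n -> seq (word n)) k r : (forall z, size (f z) = k) ->
      size (flatten (map f r)) = size r * k.
    by move=> fs; elim: r => //= z r IH; rewrite size_cat fs mulSn IH.
  by rewrite /l (gen _ _ _ near_size) near_size mulnn.
apply: leq_trans (card_size l); apply: subset_leq_card.
apply/fintype.subsetP => y; rewrite inE => /andP[_ xyF].
have [z zx yz] : exists2 z, z \in near x & y \in near z.
  by apply: (near_triangle xyF); rewrite !inE eqxx ?orbT.
by apply/flattenP; exists (near z) => //; apply: map_f.
Qed.

Lemma adj_par x : x != root -> @adj graph_of (wpar x) x.
Proof.
move=> xr; apply/andP; split.
  by apply: contraTneq (word_ord_par xr) => ->; rewrite ltnn.
apply: (tower_triangle (hle_refl x)).
  by apply/set0Pn; exists x; rewrite !inE eqxx orbT.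
by apply/fintype.subsetP => w; rewrite !inE => /orP[] ->; rewrite ?orbT.
Qed.

Lemma adj_move g x : x != wmove g x -> @adj graph_of x (wmove g x).
Proof.
move=> xg; apply/andP; split=> //.
case: (@hle_total _ x (wmove g x) g erefl) => h; apply: (tower_triangle h).
1,3: by apply/set0Pn; exists x; rewrite !inE eqxx.
1,2: by apply/fintype.subsetP => w; rewrite !inE => /orP[] ->; rewrite ?orbT.
Qed.

Lemma card_word_tower : 3 * #|word n| + 1 = 4 * 4 ^ n.
Proof.
rewrite card_bseq card_prod card_bool -[2 * 2]/4.
elim: n => [|k IH]; first by rewrite big_ord1.
rewrite big_ord_recr /= !expnS; move: IH; move: (\sum_(_ < _) _) (4 ^ k) => u v; lia.
Qed.

(** Each word of [A] below the last level has four children; a child outside [A] contributes its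
    edge to the parent to the boundary. *)
Lemma vertical_boundary A :
  4 * #|[set x in A | size x < n]| <= #|A| + #|@edge_boundary graph_of A|.
Proof.
pose B := [set w : word n | (w != root) && (wpar w \in A)].
have BA : #|B| <= #|A| + #|@edge_boundary graph_of A|.
  rewrite -(cardsID A B) leq_add //; first by apply/subset_leq_card/finset.subsetIr.
  rewrite -(@card_in_imset _ _ (fun w => (wpar w, w))) => [|u v _ _ [_ ->] //].
  apply/subset_leq_card/fintype.subsetP => _ /imsetP[w wB ->].
  by move: wB; rewrite !inE /= => /and3P[-> wr ->]; exact: adj_par.
apply: leq_trans BA; set S := [set x in A | _].
have -> : 4 * #|S| = #|finset.setX S [set: letter]|.
  by rewrite cardsX cardsT card_prod !card_bool mulnC.
rewrite -(@card_in_imset _ _ (fun p => wchild p.1 p.2)).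
  apply/subset_leq_card/fintype.subsetP => _ /imsetP[[x c] xc ->] /=.
  move: xc; rewrite !inE andbT => /andP[xA xn].
  by rewrite wchildK // xA andbT -word_size0 wchildE.
move=> [x c] [y d]; rewrite !inE !andbT /= => /andP[_ xn] /andP[_ yn] e.
have := congr1 (fun w : word n => w : seq letter) e; rewrite /= !wchildE // => -[-> xy].
by congr (_, _); apply/val_inj.
Qed.

Lemma move_boundary A g :
  #|[set x in A | wmove g x \notin A]| <= #|@edge_boundary graph_of A|.
Proof.
rewrite -(@card_in_imset _ _ (fun w => (w, wmove g w))) => [|u v _ _ [->] //].
apply/subset_leq_card/fintype.subsetP => _ /imsetP[w wA ->].
move: wA; rewrite !inE /= => /andP[wA gA]; rewrite wA gA /=.
by apply: adj_move; apply: contraNneq gA => <-.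
Qed.

End TowerGraph.

(** * From the Poincare inequality to edge expansion *)

Section Expansion.
Local Open Scope ring_scope.
Variables (R : realType) (n : nat).
Implicit Types (A : {set word n}).

Lemma sum_tuple_word (F : seq letter -> R) :
  \sum_(x : n.-tuple letter) F x = \sum_(w : word n | size w == n) F w.
Proof.
pose h (x : n.-tuple letter) : word n := insub_bseq n x.
pose h' (w : word n) : n.-tuple letter := insubd (nseq_tuple n zero_letter) (w : seq letter).
have hE x : h x = x :> seq letter by rewrite insub_bseqE // size_tuple.
have h'E (w : word n) : size w == n -> h' w = w :> seq letter.
  by move=> wn; rewrite /h' val_insubd wn.
rewrite [RHS](reindex_onto h h') => [|w wn]; last by apply/val_inj; rewrite /= hE h'E.
apply: eq_big => [x|x _]; last by rewrite hE.
by rewrite hE size_tuple eqxx; apply/esym/eqP/val_inj; rewrite /= h'E hE ?size_tuple.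
Qed.

Definition indicator A (l : seq letter) : R := (l \in [seq val w | w <- enum A])%:R.

Lemma indicatorE A w : indicator A (w : word n) = (w \in A)%:R.
Proof. by rewrite /indicator mem_map ?mem_enum //; exact: val_inj. Qed.

Lemma sum_indicator A :
  \sum_(x : n.-tuple letter) indicator A x = #|[set x in A | size x == n]|%:R.
Proof.
transitivity (\sum_(w : word n | size w == n) ((w \in A)%:R : R)).
  by rewrite (sum_tuple_word (indicator A)); apply: eq_bigr => w _; exact: indicatorE.
rewrite -sum1_card natr_sum [LHS]big_mkcond [RHS]big_mkcond; apply: eq_bigr => w _.
by rewrite inE; case: (w \in A); case: (size w == n).
Qed.

(** The summand is 1 when the move crosses the boundary of [A]. As the move is an involution, each
    crossing edge is met from both ends, whence the factor 2. *)
Lemma energy_indicator A g :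
  energy n (indicator A) g <= 2 * #|@edge_boundary (one_skeleton (tower n)) A|%:R.
Proof.
rewrite /energy (sum_tuple_word (fun x => (indicator A (move g x) - indicator A x) ^+ 2)).
set S := [set x in A | wmove g x \notin A].
have SB : #|S|%:R <= #|@edge_boundary (one_skeleton (tower n)) A|%:R :> R.
  by rewrite ler_nat; exact: move_boundary.
have S1 : \sum_w ((w \in S)%:R : R) = #|S|%:R.
  by rewrite -sum1_card natr_sum [RHS]big_mkcond; apply: eq_bigr => w _; case: ifP.
have S2 : \sum_w ((wmove g w \in S)%:R : R) = #|S|%:R.
  rewrite -S1 [RHS](reindex (wmove g)) //.
  by exists (wmove g) => w _; exact: wmoveK.
apply: (@le_trans _ _ (#|S|%:R + #|S|%:R)); last by lra.
rewrite -{1}S1 -S2 -big_split /= big_mkcond; apply: ler_sum => w _.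
rewrite -wmoveE !indicatorE !inE wmoveK.
by case: (w \in A); case: (wmove g w \in A); case: (size w == n) => //=; lra.
Qed.

(** The Poincare inequality is applied to the indicator minus its mean [q], whose square norm is a
    (1 - q). The hypothesis gives 1 - q >= 1/3, hence the constant 240 = 3 * 40 * 2. *)
Lemma top_expansion A :
  (3 * #|[set x in A | size x == n]| <= 2 * 4 ^ n)%N ->
  #|[set x in A | size x == n]|%:R <=
    240 * #|{: move_index}|%:R * #|@edge_boundary (one_skeleton (tower n)) A|%:R :> R.
Proof.
set a := #|_|; set b := #|edge_boundary _|; set c := #|_| => ab.
have N0 : 0 < (4 ^ n)%:R :> R by rewrite ltr0n expn_gt0.
pose q : R := a%:R / (4 ^ n)%:R.
pose f l := indicator A l - q.
have qN : (4 ^ n)%:R * q = a%:R by rewrite /q mulrCA divff ?mulr1 // gt_eqF.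
have sumq (r : R) : \sum_(x : n.-tuple letter) r = (4 ^ n)%:R * r.
  by rewrite sumr_const card_tuple card_prod card_bool mulr_natl.
have f0 : \sum_(x : n.-tuple letter) f x = 0.
  by rewrite sumrB sumq sum_indicator qN subrr.
have fE : \sum_(x : n.-tuple letter) f x ^+ 2 = a%:R * (1 - q).
  transitivity (\sum_(x : n.-tuple letter) (indicator A x * (1 - 2 * q) + q ^+ 2)).
    apply: eq_bigr => x _; rewrite /f /indicator; case: (_ \in _) => /=; ring.
  rewrite big_split /= -mulr_suml sumq sum_indicator -/a expr2 mulrA qN; ring.
have /= := poincare f0; rewrite fE.
have -> : \sum_g energy n f g = \sum_g energy n (indicator A) g.
  by apply: eq_bigr => g _; apply: eq_bigr => x _; rewrite /f; congr (_ ^+ 2); ring.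
have en : \sum_g energy n (indicator A) g <= c%:R * (2 * b%:R).
  rewrite mulr_natl -sumr_const; apply: ler_sum => g _.
  exact: energy_indicator.
have q23 : q <= 2 / 3.
  rewrite ler_pdivrMr //; move: ab; rewrite -(ler_nat R) !natrM; lra.
have a0 : 0 <= a%:R :> R := ler0n _ _.
by nra.
Qed.

Lemma tower_expansion A :
  (2 * #|A| <= #|word n|)%N ->
  #|A|%:R <= (320 * #|{: move_index}|%:R + 1) *
    #|@edge_boundary (one_skeleton (tower n)) A|%:R :> R.
Proof.
move=> hA; have cardV := card_word_tower n.
have vert := vertical_boundary A.
have split : (#|A| = #|[set x in A | size x == n]| + #|[set x in A | size x < n]|)%N.
  rewrite -(cardsID [set x : word n | size x == n] A).
  have -> : (A :&: [set x : word n | size x == n] = [set x in A | size x == n])%SET.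
    by apply/setP => x; rewrite !inE.
  have -> : (A :\: [set x : word n | size x == n] = [set x in A | (size x < n)%N])%SET => //.
  by apply/setP => x; rewrite !inE andbC ltn_neqAle size_bseq andbT.
move: (@top_expansion A); move: split vert.
set a := #|[set x in A | size x == n]|; set s := #|[set x in A | (size x < n)%N]|.
set b := #|edge_boundary _|; set c := #|{: move_index}| => split vert.
(* The last level holds about three quarters of all vertices, so half of the tower fills at most two
   thirds of it. *)
have a23 : (3 * a <= 2 * 4 ^ n)%N by lia.
move=> /(_ a23) top.
have : 4 * s%:R <= #|A|%:R + b%:R :> R by rewrite -natrM -natrD ler_nat.
have : #|A|%:R = a%:R + s%:R :> R by rewrite split natrD.
have : 0 <= b%:R :> R := ler0n _ _.
(* The vertical bound gives 3 s <= a + b, so a + s <= 4/3 a + b/3, and 320 is 4/3 of 240. *)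
by move: top; move: (a%:R) (b%:R) (s%:R) (c%:R) (#|A|%:R) => *; lra.
Qed.

End Expansion.

Lemma tower_dimension n : dimension (tower n.+1) = 2%N.
Proof.
apply/eqP; rewrite eqn_leq; apply/andP; split.
  by apply/bigmax_leqP => s /card_tower_face; case: #|s| => [|[|[|[]]]].
pose x : word n.+1 := insub_bseq n.+1 [:: zero_letter].
have xE : x = [:: zero_letter] :> seq letter by rewrite insub_bseqE.
pose y := wmove (false, None) x.
have yE : y = [:: (true, false)] :> seq letter by rewrite wmoveE xE.
have xy : x != y by rewrite -val_eqE /= xE yE.
(* Stated for any pair because the orientation of the edge between [x] and [y] is left
   undetermined. *)
have dim2 (u v : word n.+1) :
    hle u v -> size u = 1%N -> u != v -> (1 < dimension (tower n.+1))%N.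
  move=> uv u1 neq; pose s := [set wpar u; u; v]%SET.
  have sF : s \in faces (tower n.+1).
    apply: (tower_triangle uv); first by apply/set0Pn; exists u; rewrite !inE eqxx orbT.
    by apply/fintype.subsetP => w; rewrite !inE => /orP[/orP[]|] ->; rewrite ?orbT.
  apply: leq_trans (leq_bigmax_cond _ sF).
  rewrite /s -finset.setUA cardsU1 cards2 neq !inE.
  have par_neq (w : word n.+1) : size w = 1%N -> (wpar u == w) = false.
    by move=> w1; apply: contra_eqF w1 => /eqP <-; rewrite size_wpar u1.
  by rewrite !par_neq // -(hle_size uv).
by case: (hle_total (erefl y)) => h; apply: (dim2 _ _ h);
  rewrite ?xE ?yE // eq_sym.
Qed.

Theorem theorem9p5 (R : realType) :
  exists X : nat -> simplicial_complex,
    [/\ (forall N : nat, exists n0 : nat, forall n : nat,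
          (n0 <= n)%N -> (N <= #|X n|)%N),
        (forall n : nat, dimension (X n) = 2%N),
        (forall n : nat, collapsible (@realization R (X n))) &
        bounded_degree_expander_family R (fun n : nat => one_skeleton (X n))].
Proof.
(* The index starts at 1 because [tower 0] is a single point. *)
exists (fun n => tower n.+1); split.
- move=> N; exists N => n Nn.
  have := card_word_tower n.+1; have := ltn_expl n.+1 (isT : 1 < 4)%N.
  have -> : #|tower n.+1| = #|word n.+1| by [].
  by lia.
- by move=> n; exact: tower_dimension.
- by move=> n; exact: tower_collapsible.
split.
  by exists ((2 + (#|{: move_index}| + #|{: letter}|)) ^ 2)%N => n x; exact: tower_degree.
have K0 : (0 < 320 * #|{: move_index}|%:R + 1 :> R)%R.
  by apply: ltr_wpDl; rewrite ?ltr01 // mulr_ge0 // ler0n.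
exists (320 * #|{: move_index}|%:R + 1)^-1%R; first by rewrite invr_gt0.
move=> n A hA; rewrite ler_pdivrMl //; exact: tower_expansion.
Qed.
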